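(* There exist absolute constants $C, C_1, C_2 > 0$ such that for every natural number $n$, every attainable tuple $(s_0,\dots,s_n)$ of real numbers, and all integers $k,\ell$ with $1 \leq k < \ell \leq n$, one has $$ |s_\ell|^{\frac{1}{\ell}} \leq C \max_{k' \in \{k, k+1\}} \left( \frac{\ell}{k'}\right)^{1/2} |s_{k'}|^{\frac{1}{k'}}, $$ and moreover $$ C_1 \left( \frac{\ell}{k}\right)^{1/2} \max_{k' \in \{k, k+1\}} |s_{k'}|^{\frac{1}{k'}} \leq \max_{k' \in \{k, k+1\}} \left( \frac{\ell}{k'}\right)^{1/2} |s_{k'}|^{\frac{1}{k'}} \leq C_2 \left( \frac{\ell}{k}\right)^{1/2} \max_{k' \in \{k, k+1\}} |s_{k'}|^{\frac{1}{k'}}. $$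
   Context: For real numbers $y = (y_1,\dots,y_n) \in \mathbb{R}^n$ and $0 \leq k \leq n$, the elementary symmetric means are $$ s_k(y) := \frac{1}{\binom{n}{k}} \sum_{1 \leq i_1 < \dots < i_k \leq n} y_{i_1} \cdots y_{i_k}, $$ with $s_0(y) = 1$. An $(n+1)$-tuple $(s_0,\dots,s_n)$ of real numbers is called attainable if there exists $y \in \mathbb{R}^n$ (entries may be negative) with $s_k = s_k(y)$ for all $0 \leq k \leq n$; equivalently, the polynomial $\sum_{k=0}^n (-1)^k \binom{n}{k} s_k z^{n-k}$ is monic with all roots real. ''Absolute constant'' means a constant not depending on $n$, $k$, $\ell$ or the tuple. *)

(* Defs.v *)
From mathcomp Require Import all_boot all_order all_algebra.
From mathcomp Require Import all_classical all_reals all_analysis.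

Set Implicit Arguments.
Unset Strict Implicit.
Unset Printing Implicit Defensive.

Import Order.TTheory GRing.Theory Num.Theory.
Local Open Scope ring_scope.

(* An increasing index sequence i_1 < ... < i_k is encoded by its range, a
   k-element subset of 'I_n. *)
Definition esym_mean (R : realType) (n : nat) (y : 'I_n -> R) (k : nat) : R :=
  ('C(n, k)%:R)^-1 * \sum_(A : {set 'I_n} | #|A| == k) \prod_(i in A) y i.

Definition attainable (R : realType) (n : nat) (s : n.+1.-tuple R) : Prop :=
  exists y : 'I_n -> R, forall k : nat, (k <= n)%N -> s`_k = esym_mean y k.

Definition max_succ (R : realType) (k : nat) (F : nat -> R) : R :=
  Num.max (F k) (F k.+1).

(* Main.v *)
(* Let P(z) = sum_j C(n,j) s_j z^j = prod_j (1 + y_j z). Evaluating at z = i r,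
   with |s_n| = 1, and applying AM-GM gives Tao's inequality
     sum_j C(n,j) |s_j| r^j >= |P(i r)| = prod_j (1 + r^2 y_j^2)^(1/2)
                            >= (1 + r^2)^(n/2).
   The theorem says that, when |s_n| = 1, s_k and s_(k+1) cannot both be small:
   for a small constant d one of s_k^2 <= (d k/n)^k and
   s_(k+1)^2 <= (d (k+1)/n)^(k+1) fails. Take a counterexample of minimal n.
   Attainability passes to (s_0,...,s_m) and to (s_m,...,s_n)/s_m, by
   Gauss-Lucas. Rescaled, these are not counterexamples, which bounds s_m^2 by
   (m/n)^m for m > k+1 and by (e d (k+1)/n)^m for m < k. With these bounds the
   inequality above is violated at r^2 = L k/n for a small constant L. *)

Require Import Defs.
From mathcomp Require Import all_boot all_order all_algebra.
From mathcomp Require Import all_classical all_reals all_analysis.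
From mathcomp.real_closed Require Import complex.
From mathcomp Require Import ring lra zify.

Set Implicit Arguments.
Unset Strict Implicit.
Unset Printing Implicit Defensive.

Import Order.TTheory GRing.Theory Num.Theory.
Local Open Scope complex_scope.
Local Open Scope ring_scope.

(** * Real-rooted polynomials: derivative and polar derivative *)

(** The value [c = 0] is allowed, so that the derivative of a constant still splits. *)
Definition splits (F : fieldType) (p : {poly F}) : Prop :=
  exists (c : F) (rs : seq F), p = c *: \prod_(x <- rs) ('X - x%:P).

Definition gen_poly (R : realType) (n : nat) (s : nat -> R) : {poly R} :=
  \poly_(j < n.+1) ('C(n, j)%:R * s j).

(** A sequence replaces the tuple: truncation to a smaller [n] then leaves [s] itself unchanged, and
    entries past [n] are irrelevant. *)
Definition attains (R : realType) (n : nat) (s : nat -> R) : Prop :=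
  exists y : 'I_n -> R, forall j, (j <= n)%N -> s j = esym_mean y j.

Lemma splits_of_real_roots (R : rcfType) (p : {poly R}) :
  (forall z : R[i], root (map_poly (real_complex R) p) z -> complex.Im z = 0) ->
  splits p.
Proof.
move=> real_roots.
have [rs Ep] := closed_field_poly_normal (map_poly (real_complex R) p).
have [p0|pn0] := eqVneq p 0.
  by exists 0, [::]; rewrite p0 scale0r.
exists (lead_coef p), [seq complex.Re z | z <- rs].
apply: (map_poly_inj (real_complex R)).
rewrite Ep lead_coef_map map_polyZ /=; congr (_ *: _).
rewrite big_map rmorph_prod /=.
apply: eq_big_seq => z z_rs; rewrite rmorphB /= map_polyX map_polyC /=.
congr (_ - _%:P).
have : root (map_poly (real_complex R) p) z.
  rewrite Ep rootZ ?root_prod_XsubC //.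
  by rewrite lead_coef_eq0 map_poly_eq0.
by move/real_roots; case: z {z_rs} => a b /= ->.
Qed.

(** The logarithmic derivative of a product. *)
Lemma horner_deriv_prod (F : fieldType) (I : Type) (r : seq I)
    (f : I -> {poly F}) (z : F) :
  (forall i, (f i).[z] != 0) ->
  (\prod_(i <- r) f i)^`().[z] =
  (\prod_(i <- r) f i).[z] * \sum_(i <- r) (f i)^`().[z] / (f i).[z].
Proof.
move=> f0; elim: r => [|i r IH]; first by rewrite !big_nil derivC horner0 mulr0.
rewrite !big_cons derivM hornerD !hornerM IH.
by have := f0 i => fi0; field.
Qed.

Lemma Im_sum (R : rcfType) (I : Type) (r : seq I) (f : I -> R[i]) :
  complex.Im (\sum_(i <- r) f i) = \sum_(i <- r) complex.Im (f i).
Proof. by apply: (big_morph (@complex.Im R)) => // -[a b] [c d]. Qed.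

Lemma subr_real_neq0 (R : rcfType) (w : R[i]) (x : R) :
  complex.Im w != 0 -> w - x%:C != 0.
Proof.
case: w => a b /= b0; rewrite eq_complex /= negb_and subr0; by rewrite b0 orbT.
Qed.

(* All the terms have an imaginary part of the sign opposite to that of w. *)
Lemma sum_inv_nonreal (R : rcfType) (w : R[i]) (I : Type) (r : seq I)
    (x : I -> R) :
  complex.Im w != 0 -> (0 < size r)%N -> \sum_(i <- r) (w - (x i)%:C)^-1 != 0.
Proof.
move=> w0 r0; apply/eqP => /(congr1 (@complex.Im R)); rewrite Im_sum /= => /eqP.
have Ei i : complex.Im (w - (x i)%:C)^-1 =
    - complex.Im w * ((complex.Re w - x i) ^+ 2 + complex.Im w ^+ 2)^-1.
  by case: (w) => a b /=; rewrite subr0 mulNr.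
rewrite (eq_bigr _ (fun i _ => Ei i)) -mulr_sumr mulf_eq0 oppr_eq0 (negPf w0) /=.
apply/negP; rewrite gt_eqF //.
have pos i : 0 < ((complex.Re w - x i) ^+ 2 + complex.Im w ^+ 2)^-1.
  by rewrite invr_gt0 ltr_wpDl ?sqr_ge0 // exprn_even_gt0.
case: r r0 => // i r _; rewrite big_cons ltr_pwDl ?pos //.
by apply: sumr_ge0 => j _; apply: ltW.
Qed.

(** Gauss-Lucas for the real line: at a nonreal z the quotient p'(z)/p(z) is the sum of the 1/(z -
    x) over the real roots x, which [sum_inv_nonreal] shows to be nonzero. *)
Lemma splits_deriv (R : rcfType) (p : {poly R}) : splits p -> splits p^`().
Proof.
move=> [c [rs ->]]; rewrite derivZ.
have [->|c0] := eqVneq c 0; first by exists 0, [::]; rewrite !scale0r.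
case: (posnP (size rs)) => [/size0nil ->|rs0].
  by exists 0, [::]; rewrite !big_nil derivC scaler0 scale0r.
apply: splits_of_real_roots => z; rewrite map_polyZ /= rootZ; last first.
  by rewrite eq_complex /= negb_and c0.
rewrite -deriv_map rmorph_prod /= => rz; apply/eqP; apply: contraT => z0.
have E (x : R) : map_poly (real_complex R) ('X - x%:P) = 'X - (x%:C)%:P.
  by rewrite rmorphB /= map_polyX map_polyC.
move: rz; rewrite rootE horner_deriv_prod; last first.
  by move=> x; rewrite E hornerXsubC subr_real_neq0.
rewrite horner_prod mulf_eq0 prodf_seq_eq0.
case/orP => [/hasP [x _]|].
  by rewrite /= E hornerXsubC (negPf (subr_real_neq0 _ z0)).
rewrite (eq_bigr (fun x : R => (z - x%:C)^-1)).
  by rewrite (negPf (sum_inv_nonreal id z0 rs0)).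
by move=> x _; rewrite E derivXsubC hornerXsubC hornerC div1r.
Qed.

(* The reversal, the derivative and the second reversal of a real-rooted
   polynomial, in one operation. *)
Lemma splits_polar_deriv (R : rcfType) (n : nat) (y : 'I_n.+1 -> R) :
  let p := \prod_(i < n.+1) (1 + y i *: 'X) in
  splits (n.+1%:R *: p - 'X * p^`()).
Proof.
move=> p; apply: splits_of_real_roots => z.
have E i : map_poly (real_complex R) (1 + y i *: 'X) = 1 + (y i)%:C *: 'X.
  by rewrite rmorphD /= map_polyZ rmorph1 map_polyX.
rewrite rootE rmorphB /= map_polyZ rmorphM /= map_polyX -deriv_map rmorph_nat.
rewrite hornerD hornerN hornerZ hornerM hornerX => rz.
apply/eqP; apply: contraT => Iz; move: rz.
have z0 : z != 0 by apply: contraNneq Iz => ->.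
have Iw : complex.Im z^-1 != 0.
  case: z z0 Iz => a b; rewrite eq_complex /= => ab0 b0.
  rewrite oppr_eq0 mulf_neq0 // invr_neq0 // paddr_eq0 ?sqr_ge0 //.
  by rewrite !sqrf_eq0 negb_and b0 orbT.
have Ez (a : R) : 1 + a%:C * z = z * (z^-1 - (- a)%:C).
  by rewrite rmorphN opprK mulrDr divff // mulrC.
have fz i : (map_poly (real_complex R) (1 + y i *: 'X)).[z] = 1 + (y i)%:C * z.
  by rewrite E hornerD hornerZ hornerX hornerC.
have f0 i : (map_poly (real_complex R) (1 + y i *: 'X)).[z] != 0.
  by rewrite fz Ez mulf_neq0 // subr_real_neq0.
rewrite /p rmorph_prod /= horner_deriv_prod //.
set P := (\prod_(i < n.+1) _).[z]; set S := \sum_(i < n.+1) _.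
(* Termwise, 1 - y_i z/(1 + y_i z) = 1/(1 + y_i z) = z^-1/(z^-1 + y_i), so [sum_inv_nonreal] applies
   at the nonreal point z^-1. *)
have -> : n.+1%:R * P - z * (P * S) =
    P * (z^-1 * \sum_(i < n.+1) (z^-1 - (- y i)%:C)^-1).
  have -> : n.+1%:R * P - z * (P * S) = P * (n.+1%:R - z * S) by ring.
  congr (_ * _).
  have -> : n.+1%:R = \sum_(i < n.+1) (1 : R[i]) by rewrite sumr_const card_ord.
  rewrite /S !mulr_sumr -sumrB; apply: eq_bigr => i _.
  rewrite fz E derivD derivZ derivX derivC add0r hornerZ hornerC mulr1.
  have := f0 i; rewrite fz => fi0; rewrite -invfM -Ez.
  by apply: (mulIf fi0); rewrite mulVf // mulrBl mul1r mulrA mulfVK // mulrC; ring.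
rewrite mulf_eq0 mulf_eq0 invr_eq0 (negPf z0) /= /P horner_prod prodf_seq_eq0.
case/orP => [/hasP [i _]|]; first by rewrite /= (negPf (f0 i)).
by rewrite (negPf (sum_inv_nonreal _ Iw _)) // /index_enum -enumT size_enum_ord.
Qed.

(** * Attainable tuples: generating polynomial, truncation and shift *)

Lemma splits_const_coef_neq0 (F : fieldType) (p : {poly F}) (n : nat) :
  splits p -> p`_0 != 0 -> (size p <= n.+1)%N ->
  exists y : 'I_n -> F, p = p`_0 *: \prod_(i < n) (1 + y i *: 'X).
Proof.
move=> [c [rs ->]]; rewrite coefZ mulf_eq0 negb_or => /andP[c0 p0].
rewrite size_scale // size_prod_XsubC ltnS => rsn.
(* When there are fewer than [n] roots, [nth] returns 0 past the end and 0^-1 = 0, so the surplus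
   factors are 1. *)
exists (fun i : 'I_n => - (rs`_i)^-1).
have -> : \prod_(i < n) (1 + - (rs`_i)^-1 *: 'X) =
          \prod_(x <- rs) (1 + - x^-1 *: 'X).
  rewrite -(big_mkord xpredT (fun i => 1 + - (rs`_i)^-1 *: 'X)).
  rewrite [RHS](big_nth 0) (big_cat_nat (n := size rs)) //= [X in _ * X]big_nat.
  rewrite [X in _ * X]big1 ?mulr1 // => i /andP[ri _].
  by rewrite nth_default // invr0 oppr0 scale0r addr0.
rewrite -scalerA; congr (_ *: _).
have {}p0 : all (fun x => x != 0) rs.
  move: p0; apply: contraR => /allPn [x x_rs /negbNE /eqP x0].
  by rewrite -horner_coef0 horner_prod (big_rem x) //= hornerXsubC x0 subrr mul0r.
rewrite -horner_coef0 horner_prod.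
elim: rs p0 {rsn} => [|x rs IH] /=; first by rewrite !big_nil scale1r.
case/andP => x0 /IH {}IH; rewrite !big_cons IH hornerXsubC sub0r.
rewrite -scalerAr [- x * _]mulrC -[in RHS]scalerA; congr (_ *: _).
rewrite [in RHS]scalerAl; congr (_ * _).
by rewrite scalerDr scalerA mulrNN divff // scale1r addrC -alg_polyC scaleNr.
Qed.

Lemma coef_prod_linear (R : comNzRingType) (n : nat) (y : 'I_n -> R) (j : nat) :
  (\prod_(i < n) (1 + y i *: 'X))`_j =
  \sum_(A : {set 'I_n} | #|A| == j) \prod_(i in A) y i.
Proof.
under eq_bigr do rewrite addrC.
rewrite bigA_distr coef_sum (bigID (fun A : {set 'I_n} => #|A| == j)) /=.
rewrite [X in _ + X]big1 ?addr0 => [|A Aj]; last first.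
  rewrite -big_mkcond /= scaler_prod prodr_const coefZ coefXn eq_sym (negPf Aj).
  by rewrite mulr0.
apply: eq_bigr => A Aj.
by rewrite -big_mkcond /= scaler_prod prodr_const coefZ coefXn eq_sym Aj mulr1.
Qed.

Lemma size_gen_poly (R : realType) (n : nat) (s : nat -> R) :
  (size (gen_poly n s) <= n.+1)%N.
Proof. exact: size_poly. Qed.

Lemma attainsP (R : realType) (n : nat) (s : nat -> R) :
  attains n s <->
  exists y : 'I_n -> R, gen_poly n s = \prod_(i < n) (1 + y i *: 'X).
Proof.
have binn0 j : (j <= n)%N -> 'C(n, j)%:R != 0 :> R.
  by move=> jn; rewrite pnatr_eq0 -lt0n bin_gt0.
split=> -[y Ey]; exists y.
  apply/polyP => j; rewrite coef_poly ltnS coef_prod_linear.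
  have [jn|nj] := leqP j n; first by rewrite Ey // /esym_mean mulVKf ?binn0.
  rewrite big1 // => A /eqP Aj; have := max_card [in A].
  by rewrite Aj card_ord leqNgt nj.
move=> j jn; rewrite /esym_mean -coef_prod_linear -Ey coef_poly ltnS jn.
by rewrite mulKf ?binn0.
Qed.

Lemma attains0 (R : realType) (n : nat) (s : nat -> R) : attains n s -> s 0%N = 1.
Proof.
move=> /attainsP [y Ey]; have := congr1 (fun p : {poly R} => p.[0]) Ey.
rewrite horner_prod big1 => [|i _]; last first.
  by rewrite hornerD hornerZ hornerX mulr0 hornerC addr0.
by rewrite horner_coef0 coef_poly /= bin0 mul1r.
Qed.

Lemma eq_attains (R : realType) (n : nat) (s t : nat -> R) :
  (forall j, (j <= n)%N -> s j = t j) -> attains n s -> attains n t.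
Proof. by move=> st [y Ey]; exists y => j jn; rewrite -st // Ey. Qed.

Lemma attains_scale (R : realType) (n : nat) (s : nat -> R) (t : R) :
  attains n s -> attains n (fun j => t ^+ j * s j).
Proof.
move=> [y Ey]; exists (fun i => t * y i) => j jn; rewrite Ey // /esym_mean.
rewrite mulrCA; congr (_ * _); rewrite mulr_sumr; apply: eq_bigr => A /eqP Aj.
by rewrite big_split /= prodr_const Aj.
Qed.

Lemma attains_of_splits (R : realType) (n : nat) (s : nat -> R) :
  splits (gen_poly n s) -> s 0%N != 0 -> attains n (fun j => s j / s 0%N).
Proof.
move=> sp s0; apply/attainsP.
have c0 : (gen_poly n s)`_0 = s 0%N by rewrite coef_poly /= bin0 mul1r.
have [|y Ey] := splits_const_coef_neq0 sp _ (size_gen_poly n s).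
  by rewrite c0.
exists y; apply: (can_inj (scalerK s0)); rewrite -c0 -Ey c0.
apply/polyP => j; rewrite coefZ !coef_poly; case: ifP => _; last by rewrite mulr0.
by field.
Qed.

Lemma splits_scale (F : fieldType) (a : F) (p : {poly F}) :
  splits p -> splits (a *: p).
Proof. by move=> [c [rs ->]]; exists (a * c), rs; rewrite scalerA. Qed.

(** The polar derivative has j-th coefficient (n+1-j) C(n+1,j) s_j = (n+1) C(n,j) s_j. Thanks to the
    binomial normalisation it is, up to the factor n+1, the generating polynomial of the same
    sequence at length n. *)
Lemma attains_pred (R : realType) (n : nat) (s : nat -> R) :
  attains n.+1 s -> attains n s.
Proof.
move=> hs; have s0 := attains0 hs; case/attainsP: hs => y Ey.
apply: (@eq_attains _ _ (fun j => s j / s 0%N)) => [j _|].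
  by rewrite s0 divr1.
apply: attains_of_splits; last by rewrite s0 oner_neq0.
have := splits_scale n.+1%:R^-1 (splits_polar_deriv y); rewrite /= -Ey.
congr splits; apply/polyP => j.
have n0 : n.+1%:R != 0 :> R by rewrite pnatr_eq0.
have -> : (n.+1%:R^-1 *: (n.+1%:R *: gen_poly n.+1 s - 'X * (gen_poly n.+1 s)^`()))`_j
    = n.+1%:R^-1 * ((n.+1%:R - j%:R) * (gen_poly n.+1 s)`_j).
  rewrite coefZ coefB coefZ coefXM coef_deriv mulrBl; congr (_ * (_ - _)).
  by case: j => [|j] /=; rewrite ?mul0r // mulr_natl.
rewrite !coef_poly; apply: (mulfI n0); rewrite mulVKf //.
have [jn|nj] := leqP j n.+1; last by rewrite !ifN ?mulr0 -?leqNgt ?(ltnW nj).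
rewrite ltnS jn -natrB // mulrA -natrM -mul_bin_down /= natrM -mulrA; congr (_ * _).
by case: ifP => // /negbT; rewrite -leqNgt => nj; rewrite bin_small ?mul0r.
Qed.

Lemma attains_le (R : realType) (m n : nat) (s : nat -> R) :
  (m <= n)%N -> attains n s -> attains m s.
Proof.
move=> mn; rewrite -(subnKC mn); elim: (n - m)%N => [|d IH]; first by rewrite addn0.
by rewrite addnS => /attains_pred.
Qed.

Lemma deriv_gen_poly (R : realType) (n : nat) (s : nat -> R) :
  (gen_poly n.+1 s)^`() = n.+1%:R *: gen_poly n (fun j => s j.+1).
Proof.
apply/polyP => j; rewrite coef_deriv coefZ !coef_poly ltnS.
case: ifP => _; last by rewrite mul0rn mulr0.
by rewrite mulrA -natrM mul_bin_diag natrM -mulr_natr; ring.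
Qed.

Lemma splits_prod_linear (F : fieldType) (n : nat) (y : 'I_n -> F) :
  splits (\prod_(i < n) (1 + y i *: 'X)).
Proof.
apply: big_ind => [|p q [c [rs ->]] [d [ts ->]]|i _].
- by exists 1, [::]; rewrite big_nil scale1r.
- by exists (c * d), (rs ++ ts); rewrite big_cat /= -scalerA scalerAr scalerAl.
have [->|y0] := eqVneq (y i) 0.
  by exists 1, [::]; rewrite big_nil scale1r scale0r addr0.
exists (y i), [:: - (y i)^-1]; rewrite big_seq1 scalerBr -!mul_polyC -polyCM.
by rewrite mulrN divff // polyCN opprK addrC.
Qed.

(** By [deriv_gen_poly], each differentiation drops the first entry, up to a constant factor. After
    m of them the constant coefficient is s_m, and dividing by it restores the value 1. *)
Lemma attains_shift (R : realType) (m n : nat) (s : nat -> R) :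
  attains (m + n) s -> s m != 0 -> attains n (fun j => s (m + j)%N / s m).
Proof.
move=> /attainsP [y Ey] sm0.
have sp : splits (gen_poly (m + n) s) by rewrite Ey; exact: splits_prod_linear.
have : splits (gen_poly n (fun j => s (m + j)%N)).
  elim: m s {y Ey sm0} sp => [//|m IH] s /splits_deriv.
  rewrite addSn deriv_gen_poly => /(splits_scale (m + n).+1%:R^-1).
  by rewrite scalerA mulVf ?pnatr_eq0 // scale1r => /IH.
move/attains_of_splits; rewrite addn0; exact.
Qed.

(** * A lower bound from the imaginary axis *)

Lemma top_coef_prod_linear (R : comNzRingType) (n : nat) (y : 'I_n -> R) :
  (\prod_(i < n) (1 + y i *: 'X))`_n = \prod_(i < n) y i.
Proof.
rewrite coef_prod_linear (eq_bigl (pred1 [set: 'I_n])) ?big_pred1_eq.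
  by apply: eq_bigl => i; rewrite inE.
move=> A; rewrite /= eqEcard finset.subsetT cardsT card_ord /= eqn_leq.
by have := max_card A; rewrite card_ord => ->.
Qed.

(* AM-GM for the families [1 / (1 + x i)] and [x i / (1 + x i)], whose
   arithmetic means add up to 1. *)
Lemma prod1D_ge (R : realType) (n : nat) (x : 'I_n -> R) (q : R) :
  (forall i, 0 <= x i) -> 0 <= q -> \prod_(i < n) x i = q ^+ n ->
  (1 + q) ^+ n <= \prod_(i < n) (1 + x i).
Proof.
case: n x => [|n] x x0 q0 Eq; first by rewrite big_ord0 expr0.
have x1 i : 0 < 1 + x i by rewrite ltr_wpDr.
set G := \prod_(i < _) _.
have G0 : 0 < G by apply: prodr_gt0 => i _.
rewrite leNgt; apply/negP => Gq.
have agm (E : 'I_n.+1 -> R) : (forall i, 0 <= E i) ->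
    \prod_(i < n.+1) E i <= ((\sum_(i < n.+1) E i) / n.+1%:R) ^+ n.+1.
  move=> E0; have [+ _] := leif_AGM (fun i (_ : i \in 'I_n.+1) => E0 i).
  by rewrite card_ord.
(* If the product were less than (1+q)^(n+1), AM-GM would give a > 1/(1+q) and b >= q/(1+q), against
   a + b = 1. The second bound is not strict because q may be 0. *)
pose a := (\sum_(i < n.+1) (1 + x i)^-1) / n.+1%:R.
pose b := (\sum_(i < n.+1) x i / (1 + x i)) / n.+1%:R.
have n0 : n.+1%:R != 0 :> R by rewrite pnatr_eq0.
have ab : a + b = 1.
  rewrite -mulrDl -big_split /= (eq_bigr (fun=> 1)) => [|i _].
    by rewrite sumr_const card_ord divff.
  by have := x1 i => /lt0r_neq0 ?; field.
have q1 : 0 < 1 + q by rewrite ltr_wpDr.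
have ge_root (u v : R) : 0 <= u -> 0 <= v -> u ^+ n.+1 < v ^+ n.+1 -> u < v.
  by move=> u0 v0; rewrite ltr_pXn2r.
have a0 : 0 <= a by apply: divr_ge0 => //; apply: sumr_ge0 => i _; rewrite invr_ge0 ltW.
have b0 : 0 <= b.
  by apply: divr_ge0 => //; apply: sumr_ge0 => i _; rewrite divr_ge0 // ltW.
have la : (1 + q)^-1 < a.
  apply: ge_root => //; first by rewrite invr_ge0 ltW.
  apply: lt_le_trans (agm _ _) => [|i]; last by rewrite invr_ge0 ltW.
  by rewrite prodfV exprVn ltf_pV2 // posrE ?exprn_gt0.
have lb : q / (1 + q) <= b.
  rewrite leNgt; apply/negP => bq.
  have : b ^+ n.+1 < (q / (1 + q)) ^+ n.+1.
    by rewrite ltr_pXn2r // nnegrE divr_ge0 // ltW.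
  apply/negP; rewrite -leNgt; apply: le_trans (agm _ _) => [|i]; last first.
    by rewrite divr_ge0 // ltW.
  rewrite big_split /= prodfV Eq expr_div_n ler_wpM2l ?exprn_ge0 //.
  by rewrite lef_pV2 ?posrE ?exprn_gt0 // ltW.
have : (1 + q)^-1 + q / (1 + q) = 1 by field; apply/lt0r_neq0.
by move=> E; move: (ltr_leD la lb); rewrite ab E ltxx.
Qed.

(* Evaluate the generating polynomial at the imaginary point [r i]. *)
Lemma maclaurin_type_ineq (R : realType) (n : nat) (s : nat -> R) (r : R) :
  attains n s -> `|s n| = 1 -> 0 <= r ->
  (1 + r ^+ 2) ^+ n <= (\sum_(j < n.+1) 'C(n, j)%:R * `|s j| * r ^+ j) ^+ 2.
Proof.
move=> /attainsP [y Ey] sn r0.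
(* As |s_n| = 1 is the absolute value of the product of the y_i, [prod1D_ge] applies to the numbers
   r^2 y_i^2 with q = r^2. *)
have Py : \prod_(i < n) (r ^+ 2 * y i ^+ 2) = (r ^+ 2) ^+ n.
  rewrite big_split /= prodr_const card_ord.
  rewrite (eq_bigr (fun i => `|y i| * `|y i|)) => [|i _]; last first.
    by rewrite -normrM -expr2 ger0_norm ?sqr_ge0.
  rewrite big_split /= -normr_prod -top_coef_prod_linear -Ey coef_poly ltnSn.
  by rewrite binn mul1r sn !mulr1.
apply: le_trans (prod1D_ge _ _ Py) _ => [i||].
- by rewrite mulr_ge0 ?sqr_ge0.
- exact: sqr_ge0.
pose z : R[i] := 0 +i* r.
have Ez : (\prod_(i < n) (1 + r ^+ 2 * y i ^+ 2))%:C =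
    `|(map_poly (real_complex R) (gen_poly n s)).[z]| ^+ 2.
  rewrite rmorph_prod Ey rmorph_prod /= horner_prod normr_prod -prodrXl.
  apply: eq_bigr => i _ /=.
  have -> : map_poly (real_complex R) (1 + y i *: 'X) = 1 + (y i)%:C *: 'X.
    by rewrite rmorphD /= map_polyZ rmorph1 map_polyX.
  rewrite hornerD hornerZ hornerX hornerC.
  rewrite -add_Re2_Im2; congr (_%:C); rewrite /z /=; ring.
rewrite -lecR Ez rmorphXn lerXn2r ?nnegrE //=.
  rewrite ler0c; apply: sumr_ge0 => j _.
  by rewrite !mulr_ge0 ?exprn_ge0.
rewrite (@horner_coef_wide _ n.+1); last first.
  exact: leq_trans (size_poly _ _) (size_gen_poly _ _).
apply: le_trans (ler_norm_sum _ _ _) _; rewrite rmorph_sum /=.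
apply: ler_sum => j _; rewrite coef_map coef_poly ltn_ord normrM normrX.
have -> : `|z| = r%:C by rewrite normc_def /= expr0n add0r sqrtr_sqr ger0_norm.
rewrite rmorphM rmorphXn /= ler_wpM2r //.
  by rewrite exprn_ge0 // ler0c.
rewrite normc_def /= expr0n addr0 sqrtr_sqr lecR normrM ger0_norm //.
Qed.

(** * Exponential, binomial and geometric estimates *)

Lemma expn1D_le_expR (R : realType) (n : nat) (x : R) :
  0 <= x -> (1 + x) ^+ n <= expR (n%:R * x).
Proof.
move=> x0; rewrite expRM_natl; apply: lerXn2r (expR_ge1Dx x).
  by rewrite nnegrE addr_ge0.
by rewrite nnegrE expR_ge0.
Qed.

(** On [0,1], 1/(1+x) <= 1 - x/2 <= exp(-x/2). *)
Lemma expR_le_expn1D (R : realType) (n : nat) (x : R) :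
  0 <= x -> x <= 1 -> expR (n%:R * (x / 2)) <= (1 + x) ^+ n.
Proof.
move=> x0 x1; rewrite expRM_natl; apply: lerXn2r.
- by rewrite nnegrE expR_ge0.
- by rewrite nnegrE addr_ge0.
rewrite -lef_pV2 ?posrE ?expR_gt0 ?ltr_wpDr // -expRN.
apply: le_trans (expR_ge1Dx _); rewrite -div1r ler_pdivrMr ?ltr_wpDr //.
nra.
Qed.

(** The left side is a single term of the binomial expansion of (1 + m/n)^n, which is at most
    e^m. *)
Lemma bin_le_expn (R : realType) (n m : nat) :
  (m <= n)%N -> 'C(n, m)%:R * (m%:R / n%:R) ^+ m <= expR 1 ^+ m :> R.
Proof.
move=> mn; have [n0|n0] := posnP n.
  by move: mn; rewrite n0 leqn0 => /eqP ->; rewrite bin0 !expr0 mulr1.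
set x : R := m%:R / n%:R; have x0 : 0 <= x by rewrite divr_ge0.
have -> : expR 1 ^+ m = expR (m%:R : R) by rewrite -expRM_natl mulr1.
    have -> : (m%:R : R) = n%:R * x.
  by rewrite /x mulrC divfK // pnatr_eq0 -lt0n.
apply: le_trans (expn1D_le_expR n x0).
rewrite exprDn (bigD1 (Ordinal (mn : m < n.+1)%N)) //= expr1n mul1r mulr_natl.
by rewrite lerDl sumr_ge0 // => i _; rewrite expr1n mul1r mulrn_wge0 // exprn_ge0.
Qed.

Lemma sum_expn_ge3 (R : realType) (q : R) (n : nat) : 0 <= q -> q <= 1 / 2 ->
  \sum_(j < n | (3 <= j)%N) q ^+ j <= 2 * q ^+ 3.
Proof.
move=> q0 q1; have q3 : 0 <= q ^+ 3 by rewrite exprn_ge0.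
have [n3|n3] := leqP n 3.
  rewrite big_pred0 ?mulr_ge0 // => j; apply/negbTE; rewrite -ltnNge.
  exact: leq_trans (ltn_ord j) n3.
(* The subtracted term makes the induction close: q^n <= 2 q^n - 2 q^(n+1) because q <= 1/2. *)
suff : \sum_(j < n | (3 <= j)%N) q ^+ j <= 2 * q ^+ 3 - 2 * q ^+ n.
  by move/le_trans; apply; rewrite lerBlDr lerDl mulr_ge0 // exprn_ge0.
rewrite -(subnKC (ltnW n3)); elim: (n - 3)%N => [|d IH].
  rewrite addn0 subrr big_pred0 // => j; apply/negbTE; rewrite -ltnNge; exact: ltn_ord.
rewrite addnS big_mkcond big_ord_recr -big_mkcond /=.
have : 0 <= q ^+ (3 + d) by rewrite exprn_ge0.
rewrite [q ^+ (3 + d).+1]exprS; move: IH; set u := q ^+ (3 + d).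
by set v := q ^+ 3; set S := \sum_(_ < _ | _) _; nra.
Qed.

Lemma ex_root (R : realType) (x : R) (n : nat) : 0 < x -> (0 < n)%N ->
  exists2 t : R, 0 < t & t ^+ n = x.
Proof.
move=> x0 n0; exists (x `^ n%:R^-1); first exact: powR_gt0.
by rewrite -powR_mulrn ?powR_ge0 // -powRrM mulVf ?pnatr_eq0 -?lt0n // powRr1 // ltW.
Qed.

(** * Two consecutive small means: induction on the length *)

(** The first inequality of the theorem, normalised by |s_n| = 1, with d in the role of C^-2;
    squares avoid half-integer powers. The case n = k+1 is left out, since there the inequality is
    immediate for C >= 1. *)
Definition no_double_dip (R : realType) (d : R) (n : nat) : Prop :=
  forall (s : nat -> R) (k : nat), attains n s -> `|s n| = 1 ->
  (0 < k)%N -> (k.+2 <= n)%N ->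
  exists2 k', (k <= k' <= k.+1)%N & (d * (k'%:R / n%:R)) ^+ k' < s k' ^+ 2.

(** Rescale (s_0,...,s_m) by t with t^m = 1/|s_m|. The index k' given at length m satisfies d k'/m <
    t^2 d k'/n; here d cancels, so t^2 > n/m, which bounds s_m^2 = t^(-2m). *)
Lemma sqr_coef_le_trunc (R : realType) (d : R) (m n k : nat) (s : nat -> R) :
  0 < d -> no_double_dip d m -> attains n s -> (0 < k)%N -> (k.+2 <= m <= n)%N ->
  (forall k', (k <= k' <= k.+1)%N -> s k' ^+ 2 <= (d * (k'%:R / n%:R)) ^+ k') ->
  s m ^+ 2 <= (m%:R / n%:R) ^+ m.
Proof.
move=> d0 nd hs k0 /andP[km mn] dip.
have m0 : (0 < m)%N by apply: leq_trans km.
have n0 : (0 < n)%N by apply: leq_trans mn.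
have [sm0|sm0] := eqVneq (s m) 0.
  by rewrite sm0 expr0n exprn_ge0 // divr_ge0.
have [t t0 Et] := ex_root (x := `|s m|^-1) ltac:(by rewrite invr_gt0 normr_gt0) m0.
have [k' kk' lt_k'] := nd _ k (attains_scale t (attains_le mn hs))
  ltac:(by rewrite normrM normrX gtr0_norm // Et mulVf ?normr_eq0) k0 km.
have k'0 : (0 < k')%N by case/andP: kk' => /(leq_trans k0).
have mR : 0 < m%:R :> R by rewrite ltr0n.
have nR : 0 < n%:R :> R by rewrite ltr0n.
have kR : 0 < k'%:R :> R by rewrite ltr0n.
have t2 : 0 < t ^+ 2 by rewrite exprn_gt0.
have : (d * (k'%:R / m%:R)) ^+ k' < (t ^+ 2 * (d * (k'%:R / n%:R))) ^+ k'.
  apply: lt_le_trans lt_k' _; rewrite exprMn -exprM mulnC exprM [X in _ <= X]exprMn.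
  by rewrite ler_wpM2l ?dip // exprn_ge0 // ltW.
rewrite ltr_pXn2r ?nnegrE //; last first.
- by rewrite mulr_ge0 ?mulr_ge0 ?ltW // invr_gt0.
- by rewrite mulr_ge0 ?mulr_ge0 ?ltW // invr_gt0.
move=> lt_t; have {}lt_t : n%:R / m%:R < t ^+ 2.
  rewrite ltr_pdivrMr //; move: lt_t.
  have -> : d * (k'%:R / m%:R) = (d * k'%:R / (m%:R * n%:R)) * n%:R by field; lra.
  have -> : t ^+ 2 * (d * (k'%:R / n%:R)) =
    (d * k'%:R / (m%:R * n%:R)) * (t ^+ 2 * m%:R) by field; lra.
  by rewrite ltr_pM2l // divr_gt0 // mulr_gt0.
have -> : s m ^+ 2 = ((t ^+ 2) ^+ m)^-1.
  by rewrite -exprM mulnC exprM Et exprVn invrK real_normK ?num_real.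
rewrite -[m%:R / n%:R]invrK invf_div [X in _ <= X]exprVn lef_pV2 ?posrE ?exprn_gt0 //.
  by apply: lerXn2r; rewrite ?nnegrE ?ltW // divr_gt0.
by rewrite divr_gt0.
Qed.

(** Here [n] is the length of the shifted tuple (s_m,...,s_(m+n))/s_m, which is rescaled by t with
    t^n = |s_m|; its entry k' comes from s_(m+k'). Comparing the two bounds at k' leaves a factor
    d^m, and this is why s_m is small. *)
Lemma sqr_coef_le_shift (R : realType) (d : R) (m n k : nat) (s : nat -> R) :
  0 < d -> d * expR 1 <= 1 -> no_double_dip d n -> attains (m + n) s ->
  `|s (m + n)%N| = 1 -> (0 < k)%N -> (k.+2 <= n)%N ->
  (forall k', (k <= k' <= k.+1)%N ->
    s (m + k')%N ^+ 2 <= (d * ((m + k')%:R / (m + n)%:R)) ^+ (m + k')) ->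
  s m ^+ 2 <= (d * expR 1 * ((m + k).+1%:R / (m + n)%:R)) ^+ m.
Proof.
move=> d0 dE nd hs sn k0 kn dip.
have n0 : (0 < n)%N by apply: leq_trans kn.
have mnR : 0 < (m + n)%:R :> R by rewrite ltr0n addn_gt0 n0 orbT.
have nR : 0 < n%:R :> R by rewrite ltr0n.
have dE0 : 0 < d * expR 1 by rewrite mulr_gt0 ?expR_gt0.
have [sm0|sm0] := eqVneq (s m) 0.
  rewrite sm0 expr0n exprn_ge0 // mulr_ge0 ?(ltW dE0) //; exact: divr_ge0.
have [t t0 Et] := ex_root (x := `|s m|) ltac:(by rewrite normr_gt0) n0.
have [k' kk' lt_k'] := nd _ k (attains_scale t (attains_shift hs sm0))
  ltac:(by rewrite normrM normrX gtr0_norm // Et normf_div sn mulrC divfK ?normr_eq0)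
  k0 kn.
have /andP[k'0 k'n] : (0 < k' < n)%N by lia.
have kR : 0 < k'%:R :> R by rewrite ltr0n.
have mkR : 0 < (m + k')%:R :> R by rewrite ltr0n addn_gt0 k'0 orbT.
pose A : R := (m + k')%:R / (m + n)%:R; pose B : R := k'%:R / n%:R.
have A0 : 0 < A by rewrite divr_gt0.
have B0 : 0 < B by rewrite divr_gt0.
pose w := (t ^+ 2) ^+ (n - k').
have t20 : 0 < t ^+ 2 by rewrite exprn_gt0.
have Esm : s m ^+ 2 = (t ^+ 2) ^+ n.
  by rewrite -exprM mulnC exprM Et real_normK ?num_real.
(* Substitute s_m^2 = t^(2n) and cancel the common powers d^k' and t^(2k'). *)
have wAB : w * B ^+ k' < d ^+ m * A ^+ (m + k').
  have sm2 : 0 < s m ^+ 2 by rewrite exprn_even_gt0.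
  have : (d * B) ^+ k' * s m ^+ 2 < (t ^+ 2) ^+ k' * (d * A) ^+ (m + k').
    rewrite -ltr_pdivlMr //; apply: lt_le_trans lt_k' _.
    have -> : (t ^+ k' * (s (m + k')%N / s m)) ^+ 2 =
        (t ^+ 2) ^+ k' * (s (m + k')%N ^+ 2 / s m ^+ 2).
      by rewrite exprMn expr_div_n -!exprM mulnC.
    rewrite -[leRHS]mulrA; apply: ler_wpM2l; first by rewrite exprn_ge0 ?ltW.
    apply: ler_wpM2r; first by rewrite invr_ge0 ltW.
    by rewrite dip.
  have Et2 : (t ^+ 2) ^+ n = (t ^+ 2) ^+ k' * w.
    by rewrite /w -exprD subnKC // ltnW.
  rewrite Esm Et2 (exprMn k' d B) (exprMn (m + k') d A) (exprD d).
  have -> : d ^+ k' * B ^+ k' * ((t ^+ 2) ^+ k' * w) =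
    (d ^+ k' * (t ^+ 2) ^+ k') * (w * B ^+ k') by ring.
  have -> : (t ^+ 2) ^+ k' * (d ^+ m * d ^+ k' * A ^+ (m + k')) =
    (d ^+ k' * (t ^+ 2) ^+ k') * (d ^+ m * A ^+ (m + k')) by ring.
  by rewrite ltr_pM2l // mulr_gt0 ?exprn_gt0.
(* A/B <= 1 + m/k', and (1 + m/k')^k' <= e^m. *)
have AB : A ^+ k' <= expR 1 ^+ m * B ^+ k'.
  have : (A / B) ^+ k' <= expR 1 ^+ m.
    have -> : expR 1 ^+ m = expR (m%:R : R) by rewrite -expRM_natl mulr1.
    have -> : (m%:R : R) = k'%:R * (m%:R / k'%:R).
      by rewrite mulrC divfK // lt0r_neq0.
    apply: le_trans (expn1D_le_expR _ _); last by rewrite divr_ge0.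
    apply: lerXn2r; rewrite ?nnegrE ?addr_ge0 ?divr_ge0 ?(ltW A0) ?(ltW B0) //.
    have -> : A / B = (1 + m%:R / k'%:R) * (n%:R / (m + n)%:R).
      by rewrite /A /B natrD; field; lra.
    rewrite ler_piMr ?addr_ge0 ?divr_ge0 // ler_pdivrMr // mul1r natrD.
    by rewrite lerDr.
  by rewrite expr_div_n ler_pdivrMr ?exprn_gt0.
have w_lt : w < (d * expR 1 * A) ^+ m.
  rewrite -(ltr_pM2r (exprn_gt0 k' B0)); apply: lt_le_trans wAB _.
  have -> : (d * expR 1 * A) ^+ m * B ^+ k' =
      d ^+ m * A ^+ m * (expR 1 ^+ m * B ^+ k') by rewrite !exprMn; ring.
  rewrite exprD mulrA; apply: ler_wpM2l AB.
  by rewrite mulr_ge0 ?exprn_ge0 // ltW.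
have A1 : A <= 1 by rewrite ler_pdivrMr // mul1r ler_nat leq_add2l ltnW.
(* The bound on w concerns t^(2(n-k')), while s_m^2 = t^(2n). Once t^2 < 1 is known, s_m^2 <= w.
   This is where d e <= 1 enters. *)
have t1 : t ^+ 2 < 1.
  rewrite ltNge; apply/negP => t1; have : 1 <= w by apply: exprn_ege1.
  apply/negP; rewrite -ltNge; apply: lt_le_trans w_lt _.
  apply: exprn_ile1; first by rewrite mulr_ge0 // ltW.
  by apply: mulr_ile1 => //; apply: ltW.
rewrite Esm; apply: (@le_trans _ _ w).
  by rewrite ler_wiXn2l ?leq_subr // ltW.
apply: le_trans (ltW w_lt) _; apply: lerXn2r.
- by rewrite nnegrE mulr_ge0 // ltW.
- by rewrite nnegrE mulr_ge0 ?(ltW dE0) //; exact: divr_ge0.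
rewrite ler_pM2l // ler_pM2r ?invr_gt0 // ler_nat -addnS leq_add2l.
by case/andP: kk'.
Qed.

Lemma exists_no_double_dip (R : realType) :
  exists2 d : R, 0 < d <= 1 & forall n, no_double_dip d n.
Proof.
pose E : R := expR 1.
have E1 : 1 <= E by have := @expR_ge1Dx R 1; rewrite -/E; lra.
have E0 : 0 < E by lra.
(* Three constants: L makes e L^(1/2) = q, so that tail terms are at most q^j; q makes 2 q^3 < L/8;
   d makes 2 d e = L/64, so that |s_j| r^j <= (L p/8)^j in the head, where p = k/n and r^2 = L p. *)
pose q : R := (32 * E ^+ 2)^-1.
have q0 : 0 < q by rewrite invr_gt0 mulr_gt0 // exprn_gt0.
have Eq : q * (32 * E ^+ 2) = 1.
  by rewrite mulVf // lt0r_neq0 // mulr_gt0 // exprn_gt0.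
have E2 : 1 <= E ^+ 2 by rewrite exprn_ege1.
have q1 : q <= 1 / 32.
  have : q <= q * E ^+ 2 by rewrite ler_peMr // ltW.
  by lra.
pose L : R := (q / E) ^+ 2.
have qE0 : 0 < q / E by rewrite divr_gt0.
have L0 : 0 < L by rewrite exprn_gt0.
have LE : L * E ^+ 2 = q ^+ 2 by rewrite -exprMn divfK // lt0r_neq0.
have L1 : L <= 1.
  apply: exprn_ile1; first exact: ltW.
  by rewrite ler_pdivrMr //; lra.
pose d : R := L / (128 * E).
have dE : d * (128 * E) = L by rewrite divfK // lt0r_neq0 // mulr_gt0.
have d0 : 0 < d by rewrite divr_gt0 // mulr_gt0.
have EL : L = q ^+ 2 / E ^+ 2 by rewrite /L expr_div_n.
clearbody d; clearbody L; clearbody q.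
have dE1 : d * E <= 1 by lra.
exists d; first by rewrite d0 /=; nra.
elim/ltn_ind => n IH s k hs sn k0 kn.
apply: contrapT => no_k'.
have dip k' : (k <= k' <= k.+1)%N -> s k' ^+ 2 <= (d * (k'%:R / n%:R)) ^+ k'.
  by move=> kk'; rewrite leNgt; apply/negP => lt_k'; apply: no_k'; exists k'.
have n0 : (0 < n)%N by apply: leq_trans kn.
have nR : 0 < n%:R :> R by rewrite ltr0n.
have kR : 1 <= k%:R :> R by rewrite ler1n.
pose p : R := k%:R / n%:R.
have p0 : 0 < p by rewrite divr_gt0 //; lra.
have p1 : p <= 1 by rewrite ler_pdivrMr // mul1r ler_nat; apply: ltnW (ltnW _).
have Ep : p = k%:R / n%:R by [].
clearbody p.
have [d0' E0' p0' L0'] := And4 (ltW d0) (ltW E0) (ltW p0) (ltW L0).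
have Lp0 : 0 < L * p by rewrite mulr_gt0.
pose r : R := Num.sqrt (L * p).
have r0 : 0 <= r by rewrite sqrtr_ge0.
have r2 : r ^+ 2 = L * p by rewrite sqr_sqrtr // ltW.
have norm_le (x y : R) : 0 <= y -> x ^+ 2 <= y ^+ 2 -> `|x| <= y.
  by move=> y0 xy; rewrite -(@ler_pXn2r _ 2) ?nnegrE // real_normK ?num_real.
have term_sqr j : (`|s j| * r ^+ j) ^+ 2 = s j ^+ 2 * (L * p) ^+ j.
  by rewrite exprMn real_normK ?num_real // -exprM mulnC exprM r2.
have head j : (j <= k.+1)%N -> `|s j| * r ^+ j <= (L * p / 8) ^+ j.
  move=> jk; rewrite -[leLHS]ger0_norm ?mulr_ge0 ?exprn_ge0 //; apply: norm_le.
    by rewrite exprn_ge0 // divr_ge0 // ltW.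
  rewrite term_sqr -exprM mulnC exprM.
  suff : s j ^+ 2 <= (2 * d * E * p) ^+ j.
    move=> le_sj; apply: (@le_trans _ _ ((2 * d * E * p) ^+ j * (L * p) ^+ j)).
      by apply: ler_wpM2r le_sj; rewrite exprn_ge0 // ltW.
    rewrite -exprMn; apply: lerXn2r.
    - by rewrite nnegrE !mulr_ge0.
    - by rewrite nnegrE sqr_ge0.
    have -> : 2 * d * E = L / 64 by lra.
    by lra.
  (* A shift by j = 0 would not shorten the tuple, so the induction hypothesis would not apply; but
     s_0 = 1. *)
  have [j0|j0] := posnP j; first by rewrite j0 (attains0 hs) expr0 expr1n.
  have pow_le (x : R) : 0 <= x -> x <= 2 * p -> (d * E * x) ^+ j <= (2 * d * E * p) ^+ j.
    move=> x0 xp; apply: lerXn2r.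
    - by rewrite nnegrE !mulr_ge0.
    - by rewrite nnegrE !mulr_ge0.
    have -> : 2 * d * E * p = d * E * (2 * p) by ring.
    by apply: ler_wpM2l => //; rewrite mulr_ge0 // ltW.
  (* k + 1 <= 2k, which is the source of the factor 2 in 2 d e p. *)
  have frac_le (i : nat) : (i <= k.+1)%N -> i%:R / n%:R <= 2 * p.
    move=> ik; rewrite Ep mulrA ler_pM2r ?invr_gt0 // -natrM ler_nat.
    by apply: leq_trans ik _; rewrite mul2n -addnn -addn1 leq_add2l.
  have [kj|jk'] := leqP k j.
    apply: le_trans (dip j _) _; first by rewrite kj.
    apply: le_trans (pow_le (j%:R / n%:R) _ (frac_le j jk)); last by rewrite divr_ge0.
    apply: lerXn2r; rewrite ?nnegrE ?mulr_ge0 ?divr_ge0 ?(ltW d0) ?(ltW E0) //.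
    rewrite -mulrA; apply: ler_wpM2l; first exact: ltW.
    by apply: ler_peMl => //; exact: divr_ge0.
  have jn : (j <= n)%N by apply: leq_trans (ltnW jk') (ltnW (ltnW kn)).
  (* After a shift by j the small pair sits at k - j and k - j + 1 in a tuple of length n - j. *)
  have := @sqr_coef_le_shift R d j (n - j) (k - j) s d0 dE1 (IH _ _).
  rewrite subnKC // subnKC ?(ltnW jk') //.
  move=> /(_ _ hs sn) le_sj.
  apply: le_trans (le_sj _ _ _ _) _.
  - by rewrite -subn_gt0 subKn.
  - by rewrite subn_gt0.
  - by rewrite -subSn ?(ltnW jk') // -subSn ?leq_sub2r // ltnW // ltnW.
  - move=> k' /andP[kk' k'k]; apply: dip; rewrite -leq_subLR kk' /=.
    by rewrite -[k](subnKC (ltnW jk')) -addnS leq_add2l.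
  by apply: pow_le; [exact: divr_ge0|exact: frac_le].
(* Since p <= j/n, the square of the left side is at most (C(n,j) (j/n)^j)^2 L^j, hence at most (e^2
   L)^j = q^(2j). *)
have tail j : (k.+2 <= j <= n)%N -> 'C(n, j)%:R * `|s j| * r ^+ j <= q ^+ j.
  move=> /andP[kj jn]; have j0 : (0 < j)%N by apply: leq_trans kj.
  have le_sj : s j ^+ 2 <= (j%:R / n%:R) ^+ j.
    have [->|jn'] := eqVneq j n.
      rewrite -(real_normK (num_real (s n))) sn divff ?lt0r_neq0 //.
      by rewrite !expr1n.
    have j_lt_n : (j < n)%N by rewrite ltn_neqAle jn' jn.
    apply: (sqr_coef_le_trunc d0 (IH j j_lt_n) hs k0 _ dip).
    by rewrite kj.
  rewrite -mulrA -[leLHS]ger0_norm ?mulr_ge0 ?exprn_ge0 //; apply: norm_le.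
    by rewrite exprn_ge0 // ltW.
  rewrite exprMn term_sqr.
  pose x : R := j%:R / n%:R; have x0 : 0 <= x by apply: divr_ge0.
  have px : p <= x.
    by rewrite Ep ler_pM2r ?invr_gt0 // ler_nat (leq_trans _ kj) // ltnW.
  apply: (@le_trans _ _ (('C(n, j)%:R * x ^+ j) ^+ 2 * L ^+ j)).
    have -> : ('C(n, j)%:R * x ^+ j) ^+ 2 * L ^+ j =
              'C(n, j)%:R ^+ 2 * (x ^+ j * (L * x) ^+ j).
      by rewrite !exprMn; ring.
    apply: ler_wpM2l; first exact: sqr_ge0.
    apply: ler_pM le_sj _; rewrite ?sqr_ge0 ?exprn_ge0 ?(ltW Lp0) //.
    apply: lerXn2r; rewrite ?nnegrE ?mulr_ge0 ?(ltW L0) ?(ltW p0) //.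
    by apply: ler_wpM2l => //; exact: ltW.
  have -> : (q ^+ j) ^+ 2 = (E ^+ j) ^+ 2 * L ^+ j.
    by rewrite -!exprM mulnC !exprM -LE exprMn [RHS]mulrC -!exprM mulnC.
  apply: ler_wpM2r; first by rewrite exprn_ge0 // ltW.
  apply: lerXn2r; rewrite ?nnegrE ?mulr_ge0 ?exprn_ge0 ?(ltW E0) //.
  exact: bin_le_expn.
have := maclaurin_type_ineq hs sn r0; apply/negP; rewrite -ltNge.
(* The head bounds, extended to all j, sum to (1 + L p/8)^n by the binomial theorem. The tail starts
   at k + 2 >= 3, hence the cubic term. *)
have sum_le : \sum_(j < n.+1) 'C(n, j)%:R * `|s j| * r ^+ j <=
    (1 + L * p / 8) ^+ n + 2 * q ^+ 3.
  have -> : (1 + L * p / 8) ^+ n = \sum_(j < n.+1) 'C(n, j)%:R * (L * p / 8) ^+ j.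
    by rewrite exprDn; apply: eq_bigr => j _; rewrite expr1n mul1r mulr_natl.
  have q_half : q <= 1 / 2 by lra.
  apply: le_trans (lerD (lexx _) (sum_expn_ge3 n.+1 (ltW q0) q_half)).
  rewrite [X in _ <= _ + X]big_mkcond -big_split /=; apply: ler_sum => j _.
  have t0 : 0 <= 'C(n, j)%:R * (L * p / 8) ^+ j.
    by rewrite mulr_ge0 // exprn_ge0 // divr_ge0 // ltW.
  have q0j : 0 <= if (3 <= j)%N then q ^+ j else 0.
    by case: ifP => // _; rewrite exprn_ge0 // ltW.
  have [jk|kj] := leqP j k.+1.
    rewrite -[leLHS]addr0; apply: lerD => //; rewrite -mulrA.
    by apply: ler_wpM2l => //; exact: head.
  rewrite -[leLHS]add0r; apply: lerD => //.
  rewrite ifT; last by apply: leq_trans kj.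
  by apply: tail; rewrite kj -ltnS ltn_ord.
(* With n L p = 8a, the sum is at most e^a + 2 q^3 < e^a + a < e^(2a), using e^a >= 1 + a, whereas
   (1 + L p)^n >= e^(4a). This contradicts [maclaurin_type_ineq]. *)
pose a : R := L * k%:R / 8.
have a0 : 0 < a by rewrite divr_gt0 // mulr_gt0 //; lra.
have sum_lt : (1 + L * p / 8) ^+ n + 2 * q ^+ 3 < expR (2 * a).
  have : (1 + L * p / 8) ^+ n <= expR a.
    apply: le_trans (expn1D_le_expR _ _) _; first by rewrite divr_ge0 // ltW.
    by rewrite le_eqVlt /a Ep; apply/orP; left; apply/eqP; congr expR; field; lra.
  have := expR_ge1Dx a; rewrite mulr_natl expRM_natl.
  have : 2 * q ^+ 3 < a.
    have : L / 8 <= a by rewrite /a; nra.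
    have : 2 * q ^+ 3 < L / 8.
      rewrite EL -mulrA -invfM ltr_pdivlMr; last by rewrite mulr_gt0 // exprn_gt0.
      have -> : 2 * q ^+ 3 * (E ^+ 2 * 8) = q ^+ 2 * (q * (32 * E ^+ 2) / 2) by field.
      by rewrite Eq gtr_pMr ?exprn_gt0 //; lra.
    lra.
  set u := expR a; nra.
have -> : (1 + r ^+ 2) ^+ n = (1 + L * p) ^+ n by rewrite r2.
have le2 : expR (2 * a) ^+ 2 <= (1 + L * p) ^+ n.
  apply: le_trans (expR_le_expn1D n (ltW Lp0) _); last first.
    by apply: mulr_ile1 => //; exact: ltW.
  rewrite -expRM_natl le_eqVlt /a Ep; apply/orP; left; apply/eqP; congr expR.
  by field; lra.
apply: lt_le_trans le2; rewrite ltr_pXn2r ?nnegrE ?expR_ge0 //.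
  exact: le_lt_trans sum_lt.
by apply: sumr_ge0 => j _; rewrite !mulr_ge0 // exprn_ge0.
Qed.

(** * From the normalised statement to the theorem *)

Lemma le_max_succ (R : realType) (k k' : nat) (F : nat -> R) :
  (k <= k' <= k.+1)%N -> F k' <= max_succ k F.
Proof.
move=> kk'; have [->|->] : k' = k \/ k' = k.+1 by lia.
  by rewrite le_max lexx.
by rewrite le_max lexx orbT.
Qed.

Lemma max_succ_le (R : realType) (k : nat) (F : nat -> R) (x : R) :
  (forall k', (k <= k' <= k.+1)%N -> F k' <= x) -> max_succ k F <= x.
Proof. by move=> Fx; rewrite ge_max !Fx // leqnn leqnSn. Qed.

Lemma powR_expn (R : realType) (x : R) (n : nat) :
  0 <= x -> (0 < n)%N -> (x `^ (1 / n%:R)) ^+ n = x.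
Proof.
move=> x0 n0; rewrite -powR_mulrn ?powR_ge0 // -powRrM div1r mulVf ?powRr1 //.
by rewrite pnatr_eq0 -lt0n.
Qed.

(** Undoes the normalisation: with a = |s_l|^(1/l) and b = |s_k'|^(1/k'), rescaling by 1/a gives d
    k'/l < (b/a)^2. If s_l = 0 no rescaling is possible, but the left side is 0. *)
Lemma root_le_of_no_double_dip (R : realType) (d : R) (l k : nat) (s : nat -> R) :
  0 < d -> no_double_dip d l -> attains l s -> (0 < k)%N -> (k.+2 <= l)%N ->
  exists2 k', (k <= k' <= k.+1)%N &
    `|s l| `^ (1 / l%:R) <=
    Num.sqrt d^-1 * ((l%:R / k'%:R) `^ (1 / 2) * `|s k'| `^ (1 / k'%:R)).
Proof.
move=> d0 nd hs k0 kl; have l0 : (0 < l)%N by apply: leq_trans kl.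
have [sl0|sl0] := eqVneq (s l) 0.
  exists k; first by rewrite leqnn leqnSn.
  rewrite sl0 normr0 powR0 ?mulr_ge0 ?powR_ge0 ?sqrtr_ge0 //.
  by rewrite div1r invr_eq0 pnatr_eq0 -lt0n.
pose a := `|s l| `^ (1 / l%:R).
have a0 : 0 < a by rewrite powR_gt0 ?normr_gt0.
have Ea : a ^+ l = `|s l| by rewrite powR_expn.
have [k' kk' lt_k'] := nd _ k (attains_scale a^-1 hs)
  ltac:(by rewrite normrM normrX gtr0_norm ?invr_gt0 // exprVn Ea mulVf ?normr_eq0)
  k0 kl.
exists k' => //.
have k'0 : (0 < k')%N by case/andP: kk' => /(leq_trans k0).
have lR : 0 < l%:R :> R by rewrite ltr0n.
have kR : 0 < k'%:R :> R by rewrite ltr0n.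
pose b := `|s k'| `^ (1 / k'%:R).
have b0 : 0 <= b by rewrite powR_ge0.
have Eb : b ^+ k' = `|s k'| by rewrite powR_expn.
have lt_ab : d * (k'%:R / l%:R) < (b / a) ^+ 2.
  rewrite -(@ltr_pXn2r _ k') ?nnegrE ?sqr_ge0 ?mulr_ge0 ?invr_ge0 ?(ltW d0) //.
  apply: lt_le_trans lt_k' _; rewrite -exprM mulnC exprM expr_div_n Eb.
  rewrite -(real_normK (num_real (_ * _))) normrM normrX normfV (gtr0_norm a0).
  by rewrite exprVn mulrC.
rewrite -/a -/b mulrA.
have c0 : 0 <= Num.sqrt d^-1 * (l%:R / k'%:R) `^ (1 / 2).
  by rewrite mulr_ge0 ?sqrtr_ge0 ?powR_ge0.
rewrite -(@ler_pXn2r _ 2) ?nnegrE ?mulr_ge0 ?(ltW a0) ?sqrtr_ge0 ?powR_ge0 //.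
rewrite !exprMn sqr_sqrtr ?invr_ge0 ?(ltW d0) // (powR_expn (n := 2)) ?divr_ge0 //.
move: lt_ab; rewrite expr_div_n ltr_pdivlMr ?exprn_gt0 // => /ltW lt_ab.
have -> : a ^+ 2 = d^-1 * (l%:R / k'%:R) * (d * (k'%:R / l%:R) * a ^+ 2).
  by field; lra.
by apply: ler_wpM2l lt_ab; rewrite mulr_ge0 ?invr_ge0 ?divr_ge0 ?(ltW d0).
Qed.

Theorem theorem1p1 (R : realType) :
  exists C C1 C2 : R,
    [/\ 0 < C, 0 < C1, 0 < C2 &
     forall (n : nat) (s : n.+1.-tuple R), attainable s ->
     forall k l : nat, (1 <= k)%N -> (k < l)%N -> (l <= n)%N ->
     [/\ `|s`_l| `^ (1 / l%:R) <=
           C * max_succ k (fun k' =>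
                 (l%:R / k'%:R) `^ (1 / 2) * `|s`_k'| `^ (1 / k'%:R)),
         C1 * (l%:R / k%:R) `^ (1 / 2) *
             max_succ k (fun k' => `|s`_k'| `^ (1 / k'%:R)) <=
           max_succ k (fun k' =>
             (l%:R / k'%:R) `^ (1 / 2) * `|s`_k'| `^ (1 / k'%:R)) &
         max_succ k (fun k' =>
             (l%:R / k'%:R) `^ (1 / 2) * `|s`_k'| `^ (1 / k'%:R)) <=
           C2 * (l%:R / k%:R) `^ (1 / 2) *
             max_succ k (fun k' => `|s`_k'| `^ (1 / k'%:R))]].
Proof.
have [d /andP[d0 d1] nd] := exists_no_double_dip R.
have C0 : 1 <= Num.sqrt d^-1.
  by rewrite -sqrtr1 ler_sqrt ?invf_ge1 // invr_ge0 ltW.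
(* [C1] comes from k' <= k + 1 <= 2k and [C2] from k' >= k. *)
exists (Num.sqrt d^-1), ((1 / 2) `^ (1 / 2)), 1.
split=> //; first exact: lt_le_trans C0.
move=> n s [y Ey] k l k0 kl ln.
have l0 : (0 < l)%N by apply: leq_trans kl.
(* Truncation at l makes s_l the last entry. *)
have hs : attains l (fun j => s`_j).
  by apply: (attains_le ln); exists y => j jn; rewrite Ey.
set F := fun k' : nat => _ * _; set G := fun k' : nat => `|s`_k'| `^ _.
have F0 k' : 0 <= F k' by rewrite mulr_ge0 ?powR_ge0.
split.
- have [kl2|] := leqP k.+2 l.
    have [k' kk' le_k'] := root_le_of_no_double_dip d0 (nd l) hs k0 kl2.
    apply: le_trans le_k' _; apply: ler_wpM2l; first exact: sqrtr_ge0.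
    exact: (le_max_succ F kk').
  (* For l = k + 1 the left side is the term k' = k + 1 of the maximum, since then l/k' = 1; [C] >=
     1 suffices. *)
  rewrite ltnS => lk; have El : l = k.+1 by apply/eqP; rewrite eqn_leq lk.
  have EF : `|s`_l| `^ (1 / l%:R) = F k.+1.
    by rewrite /F -El divff ?powR1 ?mul1r // pnatr_eq0 -lt0n.
  rewrite EF; apply: (@le_trans _ _ (max_succ k F)).
    by apply: le_max_succ; rewrite leqnSn leqnn.
  apply: ler_peMl => //; apply: le_trans (F0 k.+1) (le_max_succ F _).
  by rewrite leqnSn leqnn.
- rewrite -powRM ?divr_ge0 //; set c := _ `^ _.
  have c0 : 0 < c by rewrite powR_gt0 // mulr_gt0 // divr_gt0 // ltr0n.
  rewrite mulrC -ler_pdivlMr //; apply: max_succ_le => k' kk'.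
  rewrite ler_pdivlMr //.
  apply: le_trans (le_max_succ F kk'); rewrite /F mulrC.
  apply: ler_wpM2r; first exact: powR_ge0.
  have k'0 : (0 < k')%N by case/andP: kk' => /(leq_trans k0).
  apply: ge0_ler_powR; rewrite ?nnegrE ?mulr_ge0 ?invr_ge0 //.
  have -> : 1 / 2 * (l%:R / k%:R) = l%:R * (2 * k%:R)^-1 :> R.
    by field; rewrite pnatr_eq0 -lt0n.
  apply: ler_wpM2l => //; rewrite lef_pV2 ?posrE ?mulr_gt0 ?ltr0n //.
  rewrite -natrM ler_nat; case/andP: kk' => _ /leq_trans; apply.
  by rewrite mul2n -addnn -addn1 leq_add2l.
rewrite mul1r; apply: max_succ_le => k' kk'; rewrite /F.
have k'0 : (0 < k')%N by case/andP: kk' => /(leq_trans k0).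
apply: ler_pM; rewrite ?powR_ge0 //; last exact: (le_max_succ G kk').
apply: ge0_ler_powR; rewrite ?nnegrE ?mulr_ge0 ?invr_ge0 //.
apply: ler_wpM2l => //; rewrite lef_pV2 ?posrE ?ltr0n // ler_nat.
by case/andP: kk'.
Qed.
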